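(* Let $\mathcal{P}$ be a hereditary property of ordered graphs, let $\mathcal{P}_n$ be the set of its members with vertex set $[n]$, and suppose that $|\mathcal{P}_m| < F_m$ for some $m \in \mathbb{N}$. Then there exist integers $K, N \geqslant 0$ and $a_0, \ldots, a_K \in \mathbb{Z}$ such that $|\mathcal{P}_n| = \sum_{i = 0}^K a_i \binom{n}{i}$ for every $n \geqslant N$.
   Context: An ordered graph is a graph with a linear order on its vertices; an ordered graph of order $n$ has vertex set $[n]$ with the natural order. Induced ordered subgraphs are given by injective order-preserving maps preserving adjacency and non-adjacency. A hereditary property of ordered graphs is a collection of ordered graphs closed under order-preserving isomorphism and under taking induced ordered subgraphs. $F_m$ denotes the Fibonacci number $F_{m,2}$, where $F_{n,2}=0$ for $n<0$, $F_{0,2}=1$, and $F_{n,2}=F_{n-1,2}+F_{n-2,2}$ for $n\geqslant 1$. *)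

(* Defs.v *)
From mathcomp Require Import all_boot all_order all_algebra.
Set Implicit Arguments. Unset Strict Implicit. Unset Printing Implicit Defensive.
Import GRing.Theory Num.Theory.

(* An ordered graph of order n: vertex set [n] = 'I_n with its natural order,
   given by a symmetric irreflexive boolean adjacency relation. *)
Definition adj (n : nat) := {ffun 'I_n * 'I_n -> bool}.

Definition is_ograph (n : nat) (g : adj n) : bool :=
  [forall i : 'I_n, ~~ g (i, i)] && [forall i : 'I_n, forall j : 'I_n, g (i, j) == g (j, i)].

Definition induced (m n : nat) (f : 'I_m -> 'I_n) (g : adj n) : adj m :=
  [ffun p : 'I_m * 'I_m => g (f p.1, f p.2)].

(* A property of ordered graphs: for each n, a predicate on ordered graphs with vertex set [n].
   (Closure under order-preserving isomorphism is automatic: the only order-preserving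
   bijection [n] -> [n] is the identity.) *)
Definition oprop := forall n : nat, pred (adj n).

Definition hereditary (P : oprop) : Prop :=
  forall (n m : nat) (g : adj n) (f : 'I_m -> 'I_n),
    is_ograph g -> P n g ->
    (forall i j : 'I_m, (i < j)%N -> (f i < f j)%N) ->
    P m (induced f g).

Definition countP (P : oprop) (n : nat) : nat :=
  #|[pred g : adj n | is_ograph g && P n g]|.

Fixpoint fib (n : nat) : nat :=
  match n with
  | 0 => 1
  | 1 => 1
  | (k.+1 as k1).+1 => fib k1 + fib k
  end.

(* Main.v *)
Require Import Defs.
From mathcomp Require Import all_boot all_order all_algebra.
From mathcomp Require Import zify ring.
From Stdlib Require Import Classical.
Import GRing.Theory Num.Theory.

Set Implicit Arguments.
Unset Strict Implicit.
Unset Printing Implicit Defensive.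

(* Call i a break of an ordered graph if the consecutive vertices i and i+1 are
   adjacent to different sets of other vertices. The breaks cut the graph into
   intervals whose vertices are twins, so a graph with few breaks is a blow-up of a
   small graph T by block sizes x.

   If the members of P have arbitrarily many breaks, each with a witness
   v outside {i, i+1}, Ramsey's theorem makes a large family of triples (i, i+1, v)
   homogeneous. Then either one vertex distinguishes the two vertices in many disjoint
   pairs, or there is an (induced, up to complementation) consecutive matching, or a
   matching or half graph between two intervals. Each of these contains Fibonacci many
   ordered graphs on n vertices: along a path z_1, ..., z_n of candidate vertices one
   may independently alter the adjacency of any disjoint consecutive pairs
   z_k, z_(k+1).

   If the number of breaks is bounded, there are finitely many T, and for each T the
   admissible x form the intersection of a down-set with an up-set of N^l. By
   Dickson's lemma membership depends only on the truncations min(x_i, M), so the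
   number of admissible x of sum n has eventually vanishing iterated differences. *)

(** * Fibonacci lower bounds *)

(** Adjacency made total, false outside the vertex set, so that vertices can be handled as plain
    numbers. *)
Definition ext n (g : adj n) (i j : nat) : bool :=
  if (insub i : option 'I_n) is Some a then
    if (insub j : option 'I_n) is Some b then g (a, b) else false
  else false.

Lemma extE n (g : adj n) (i j : 'I_n) : ext g i j = g (i, j).
Proof. by rewrite /ext !valK. Qed.

Lemma ext_lt n (g : adj n) i j (hi : i < n) (hj : j < n) :
  ext g i j = g (Ordinal hi, Ordinal hj).
Proof. exact: (extE g (Ordinal hi) (Ordinal hj)). Qed.

Lemma ext_default n (g : adj n) i j : ~~ ((i < n) && (j < n)) -> ext g i j = false.
Proof.
rewrite /ext; case: insubP => [a ha _|//]; case: insubP => [b hb _|//].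
by rewrite ha hb.
Qed.

Lemma ext_sym n (g : adj n) i j : is_ograph g -> ext g i j = ext g j i.
Proof.
case/andP=> _ /forallP h; rewrite /ext; case: insubP => [a _ _|_]; case: insubP => [b _ _|_] //.
by apply/eqP; move/forallP: (h a).
Qed.

Lemma adj_eq n (g h : adj n) :
  (forall i j, i < n -> j < n -> ext g i j = ext h i j) -> g = h.
Proof. by move=> H; apply/ffunP=> -[i j]; rewrite -!extE H. Qed.

(* Binary words of length n that end in 0 and have no two consecutive 1s. *)
Fixpoint codes (n : nat) : seq (seq bool) :=
  match n with
  | 0 => [:: [::]]
  | 1 => [:: [:: false]]
  | (k.+1 as k1).+1 =>
      [seq false :: u | u <- codes k1] ++ [seq true :: false :: u | u <- codes k]
  end.

Lemma two_step_ind (Q : nat -> Prop) :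
  Q 0 -> Q 1 -> (forall n, Q n -> Q n.+1 -> Q n.+2) -> forall n, Q n.
Proof.
move=> q0 q1 qS n; suff: Q n /\ Q n.+1 by case.
by elim: n => [|n [qn qn1]]; split=> //; apply: qS.
Qed.

Lemma size_codes n : size (codes n) = fib n.
Proof.
elim/two_step_ind: n => // n h0 h1.
by rewrite [codes _]/= size_cat !size_map h1 h0.
Qed.

Lemma uniq_codes n : uniq (codes n).
Proof.
elim/two_step_ind: n => // n h0 h1.
rewrite [codes _]/= cat_uniq !map_inj_uniq ?h0 ?h1 //; last 2 first.
- by move=> x y [].
- by move=> x y [].
rewrite andbT; apply/hasPn=> _ /mapP[u _ ->]; apply/mapP=> -[v _]; by [].
Qed.

Lemma codesP n u : u \in codes n ->
  [/\ size u = n, forall i, nth false u i -> i.+1 < n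
    & forall i, nth false u i -> nth false u i.+1 = false].
Proof.
elim/two_step_ind: n u => [||n h0 h1] u.
- by rewrite inE => /eqP->; split=> // i; rewrite nth_nil.
- by rewrite inE => /eqP->; split=> // -[|[]].
rewrite [codes _]/= mem_cat => /orP[] /mapP[v hv ->].
  have [s1 s2 s3] := h1 _ hv; split=> [|[|i]|[|i]] //=; first by rewrite s1.
  - by move/s2.
  - exact: s3.
have [s1 s2 s3] := h0 _ hv; split=> [|[|[|i]]|[|[|i]]] //=; first by rewrite s1.
- by move/s2.
- exact: s3.
Qed.

Section Family.

Variables (P : oprop) (n N : nat) (g : adj N).
Hypotheses (hP : hereditary P) (og : is_ograph g) (Pg : P g).
Let E := ext g.

(** A code [u] selects the vertices [f u 0 < f u 1 < ...] of [g]. In the induced graph the pair of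
    positions [(p i, q i)] reveals bit [i], up to the fixed offset [c i], so distinct codes give
    distinct members of [P]. *)
Lemma fib_le_countP (f : seq bool -> nat -> nat) (p q : nat -> nat) (c : nat -> bool) :
  (forall u, u \in codes n -> forall i j, i < j < n -> f u i < f u j) ->
  (forall u, u \in codes n -> forall i, i < n -> f u i < N) ->
  (forall i, i.+1 < n -> p i < n /\ q i < n) ->
  (forall u, u \in codes n -> forall i, i.+1 < n ->
     E (f u (p i)) (f u (q i)) = c i (+) nth false u i) ->
  fib n <= countP P n.
Proof.
move=> fmono fN hpq dec.
pose G u : adj n := [ffun x : 'I_n * 'I_n => E (f u x.1) (f u x.2)].
have inj : {in codes n &, injective G}.
  move=> u v hu hv eG.
  have [su u0 _] := codesP hu; have [sv v0 _] := codesP hv.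
  apply: (@eq_from_nth _ false) => [|i _]; first by rewrite su sv.
  (* The last letter of a code is 0, so only the bits before it need decoding. *)
  case: (ltnP i.+1 n) => [hi|hi]; last first.
    have -> : nth false u i = false by apply/negP => /u0; rewrite ltnNge hi.
    by have -> : nth false v i = false by apply/negP => /v0; rewrite ltnNge hi.
  have [hp hq] := hpq _ hi.
  have := congr1 (fun h : adj n => h (Ordinal hp, Ordinal hq)) eG.
  by rewrite !ffunE /= !dec //; apply: addbI.
rewrite -size_codes -(size_map G) /countP cardE.
apply: uniq_leq_size; first by rewrite map_inj_in_uniq // uniq_codes.
move=> _ /mapP[u hu ->]; rewrite mem_enum inE.
have -> : G u = induced (fun i : 'I_n => Ordinal (fN u hu i (ltn_ord i))) g.
  by apply/ffunP=> -[i j]; rewrite !ffunE /=; exact: ext_lt.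
apply/andP; split; last first.
  by apply: (hP og Pg) => i j hij /=; apply: fmono => //; rewrite hij /=.
case/andP: og => /forallP o1 /forallP o2; apply/andP; split.
  by apply/forallP=> i; rewrite ffunE.
by apply/forallP=> i; apply/forallP=> j; rewrite !ffunE; apply: (forallP (o2 _)).
Qed.

(** Choosing [A i] or [B i] for each [i] writes any word into the row of [v], which itself takes the
    last or the first position. *)
Lemma fib_le_alternating (A B : nat -> nat) v :
  v < N ->
  (forall i, i < n -> A i < N /\ B i < N) ->
  (forall i j, i < j < n -> [/\ A i < A j, A i < B j, B i < A j & B i < B j]) ->
  (forall i, i < n -> E (A i) v != E (B i) v) ->
  (forall i, i < n -> A i < v /\ B i < v) \/ (forall i, i < n -> v < A i /\ v < B i) ->
  fib n <= countP P n.
Proof.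
move=> vN ABN ABm ABv side.
pose pick (u : seq bool) i := if E (A i) v == nth false u i then A i else B i.
have pickE u i : i < n -> E (pick u i) v = nth false u i.
  move=> /ABv; rewrite /pick.
  by case eA: (E (A i) v); case eB: (E (B i) v); case: nth; rewrite /= ?eA ?eB.
have pickN u i : i < n -> pick u i < N.
  by move=> /ABN[]; rewrite /pick; case: ifP.
have pickm u i j : i < j < n -> pick u i < pick u j.
  by move=> /ABm[]; rewrite /pick; case: ifP => _; case: ifP => _.
case: side => side.
- apply: (@fib_le_countP (fun u i => if i.+1 < n then pick u i else v)
     id (fun=> n.-1) (fun=> false)) => [u hu i j hij|u hu i hi|i hi|u hu i hi].
  + have -> : i.+1 < n by lia.
    case: ifP => hj; first exact: pickm.
    have [|s1 s2] := side i; first by lia.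
    by rewrite /pick; case: ifP.
  + by case: ifP => // _; apply: pickN.
  + by split; lia.
  + rewrite hi; have -> : (n.-1.+1 < n) = false by lia.
    by rewrite pickE //; lia.
- apply: (@fib_le_countP (fun u i => if i is i'.+1 then pick u i' else v)
     succn (fun=> 0) (fun=> false)) => [u hu i j hij|u hu i hi|i hi|u hu i hi].
  + case: j hij => [|j] hij; first by lia.
    case: i hij => [|i] hij; last by apply: pickm; lia.
    have [|s1 s2] := side j; first by lia.
    by rewrite /pick; case: ifP.
  + by case: i hi => // i hi; apply: pickN; lia.
  + by split; lia.
  + by rewrite pickE //; lia.
Qed.

(** A 1 at position [i] replaces [X (i + 1)] by [V i], the partner of [X i]. As codes have no two
    consecutive 1s, position [i] still holds [X i], so exactly this consecutive pair becomes
    exceptional. *)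
Lemma fib_le_matching (X V : nat -> nat) a :
  (forall i, i < n -> X i < V i < N) ->
  (forall i j, i < j < n -> V i < X j) ->
  (forall i, i < n -> E (X i) (V i) = ~~ a) ->
  (forall i j, i < j < n -> E (X i) (X j) = a) ->
  (forall i j, i < j < n -> E (V i) (X j) = a) ->
  fib n <= countP P n.
Proof.
move=> XV VX eXV eXX eVX.
pose f (u : seq bool) i :=
  if i is i'.+1 then if nth false u i' then V i' else X i else X 0.
have fle u i : i < n -> f u i <= X i.
  case: i => // i hi /=; case: ifP => // _; apply: ltnW; apply: VX; lia.
have fge u i : i.+1 < n -> V i <= f u i.+1.
  move=> hi /=; case: ifP => // _; apply: ltnW; apply: VX; lia.
apply: (@fib_le_countP f id succn (fun=> a)) => [u hu i j hij|u hu i hi|i hi|u hu i hi].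
- case: j hij => [|j] hij; first by lia.
  have h1 := fle u i ltac:(lia); have h2 := fge u j ltac:(lia).
  have h3 := XV j ltac:(lia).
  have : X i <= X j; last by lia.
  case: (ltngtP i j) => [h| |->] //; last by lia.
  by have := VX i j ltac:(lia); have := XV i ltac:(lia); lia.
- by have := fle u i hi; have := XV i hi; lia.
- by split; lia.
- have [_ _ u2] := codesP hu.
  rewrite /f -/(f u i); case: ifP => hui.
    have -> : f u i = X i.
      by case: i hi hui => // i hi hui /=; case: ifP => // /u2; rewrite hui.
    by rewrite eXV ?addbT //; lia.
  rewrite addbF; case: i hi hui => [|i] hi hui /=; first by apply: eXX; lia.
  by case: ifP => _; [apply: eVX; lia|apply: eXX; lia].
Qed.

(* Along z_i = X_(t i) for even i and V_(t i) for odd i: a 1 at position i of the code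
   swaps the indices of z_i and z_(i+1) in the half graph case [a != b] and makes them
   equal in the matching case, which flips the adjacency of z_i and z_(i+1) only. *)
Lemma fib_le_separated (X V : nat -> nat) a b (d : bool) :
  (forall i j, i <= n -> j <= n -> X i < V j < N) ->
  (forall i j, i < j <= n -> X i < X j) ->
  (forall i j, i < j <= n -> if d then V j < V i else V i < V j) ->
  (forall i, i <= n -> E (X i) (V i) = ~~ a) ->
  (forall i j, i < j <= n -> E (X i) (V j) = a) ->
  (forall i j, i < j <= n -> E (X j) (V i) = b) ->
  fib n <= countP P n.
Proof.
move=> XV Xm Vm e0 ea eb.
pose prev (u : seq bool) i := if i is i'.+1 then nth false u i' else false.
pose t (u : seq bool) i := i + (nth false u i && (a != b)) - prev u i.
pose f (u : seq bool) k :=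
  if k < uphalf n then X (t u k.*2)
  else V (t u (if d then n.-1 - k else k - uphalf n).*2.+1).
(* Rank of [z_i] among the chosen vertices: first the [uphalf n] vertices from [X], then those from
   [V], listed backwards when [V] is decreasing. *)
pose pos i := if odd i then if d then n.-1 - i./2 else uphalf n + i./2 else i./2.
have tn u i : u \in codes n -> i < n -> t u i <= n.
  by move=> hu hi; rewrite /t; lia.
(* Indices two apart keep their order because consecutive 1s are excluded; hence the vertices taken
   from [X], and likewise from [V], stay sorted. *)
have tm u i j : u \in codes n -> i.+1 < j -> t u i < t u j.
  move=> hu hij; have [_ _ u2] := codesP hu; rewrite /t.
  case: j hij => // j hij; rewrite [prev u j.+1]/=.
  have := u2 i; case: (nth false u i) => /=; last by lia.
  case: (eqVneq j i.+1) => [->|]; last by lia.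
  by move=> ->; lia.
have fX u i : i < n -> ~~ odd i -> f u (pos i) = X (t u i).
  move=> hi ho; rewrite /pos (negbTE ho) /f.
  by have -> : i./2 < uphalf n; [lia|rewrite even_halfK].
have fV u i : i < n -> odd i -> f u (pos i) = V (t u i).
  move=> hi ho; rewrite /pos ho /f.
  have -> : ((if d then n.-1 - i./2 else uphalf n + i./2) < uphalf n) = false.
    by case: (d); lia.
  by congr (V (t u _)); case: (d); lia.
have posn i : i < n -> pos i < n by rewrite /pos; case: ifP; case: (d); lia.
apply: (@fib_le_countP f pos (fun i => pos i.+1) (fun i => if odd i then b else a))
  => [u hu i j hij|u hu i hi|i hi|u hu i hi].
- rewrite /f; case hi: (i < uphalf n); case hj: (j < uphalf n).
  + by apply: Xm; rewrite tm ?tn //; lia.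
  + case/andP: (XV (t u i.*2)
      (t u (if d then n.-1 - j else j - uphalf n).*2.+1) ltac:(apply: tn => //; lia)
      ltac:(apply: tn => //; case: (d); lia)) => //.
  + by lia.
  + by case: (d) Vm => /= Vm; apply: Vm; rewrite tm ?tn //; lia.
- have h0 k : k <= n -> V k < N by move=> hk; case/andP: (XV 0 k (leq0n _) hk).
  rewrite /f; case: ifP => hk.
    by case/andP: (XV (t u i.*2) 0 ltac:(apply: tn => //; lia) (leq0n _)); apply: ltn_trans.
  by apply: h0; apply: tn => //; case: (d); lia.
- by split; apply: posn; lia.
- have [_ u1 u2] := codesP hu.
  have ti : t u i <= n by apply: tn => //; lia.
  have ti1 : t u i.+1 <= n by apply: tn.
  have [tu tnu] : (nth false u i -> t u i = i + (a != b) /\ t u i.+1 = i)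
     /\ (~~ nth false u i -> t u i < t u i.+1).
    split=> hui; last first.
      by rewrite /t /= (negbTE hui) /=; lia.
    rewrite /t /= (u2 _ hui) hui /=.
    have -> : prev u i = false.
      by case: (i) hui => //= k hk; apply/negP => /u2; rewrite hk.
    by lia.
  case: ifP => ho.
    rewrite fV ?fX //=; try lia.
    rewrite {1}/E (ext_sym _ _ og) -/E.
    case hui: (nth false u i); last first.
      by rewrite addbF; apply: eb; rewrite ti1 tnu ?hui.
    have [] := tu hui => -> ->; case: (eqVneq a b) => [<-|hab] /=.
      by rewrite addn0 e0 ?addbT //; lia.
    by rewrite ea; [case: (a) (b) hab => -[] | lia].
  rewrite fX ?fV ?ho //=; try lia.
  case hui: (nth false u i); last first.
    by rewrite addbF; apply: ea; rewrite ti1 tnu ?hui.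
  have [] := tu hui => -> ->; case: (eqVneq a b) => [_|hab] /=.
    by rewrite addn0 e0 ?addbT //; lia.
  by rewrite eb; [case: (a) (b) hab => -[] | lia].
Qed.

End Family.

(** * Graphs with many breaks *)

(** Induction on the sum of the target sizes: the head of the list keeps the later elements joined
    to it by a frequent colour [c], and the target of [c] drops by one. The bound sits in a sigma
    type so that the bounds for all colours can be summed. *)
Lemma ramsey (C : finType) k (q : C -> nat) : \sum_c q c <= k ->
  {N | forall (col : nat -> nat -> C) s, N <= size s -> exists c s',
    [/\ subseq s' s, size s' = q c & pairwise (fun x y => col x y == c) s']}.
Proof.
elim: k q => [|k IH] q hq.
  exists 1 => col [|x s] // _; exists (col x x), [::]; split=> //.
  by move: hq; rewrite (bigD1 (col x x)) //=; lia.
case: (pickP (fun c => q c == 0)) => [c /eqP qc|q_gt0].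
  by exists 0 => col s _; exists c, [::]; rewrite sub0seq qc.
pose q' c d := q d - (d == c).
have hq' c : \sum_d q' c d <= k.
  have h := q_gt0 c; rewrite (bigD1 c) //= in hq; rewrite (bigD1 c) //= /q' eqxx.
  rewrite (eq_bigr q) => [|d /negbTE->]; last by rewrite subn0.
  by lia.
pose M c := proj1_sig (IH _ (hq' c)).
exists (\sum_c M c).+2 => col [//|x s] /= hs.
have [c hc] : exists c, M c <= count (fun y => col x y == c) s.
  apply/existsP; apply: contraLR hs => /existsPn h; rewrite -leqNgt.
  have -> : size s = \sum_c count (fun y => col x y == c) s.
    elim: s {h} => [|y s IHs] /=; first by rewrite big1.
    rewrite big_split /= -IHs (bigD1 (col x y)) //= eqxx big1 // => c /negbTE.
    by rewrite eq_sym => ->.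
  by apply: leq_sum => c _; have := h c; rewrite -ltnNge => /ltnW.
rewrite -size_filter in hc.
have [d [s' [ss szs ps]]] := proj2_sig (IH _ (hq' c)) col _ hc.
have ss' : subseq s' s by apply: subseq_trans ss (filter_subseq _ _).
case: (eqVneq d c) => [dc|ndc]; last first.
  exists d, s'; split=> //; last by rewrite szs /q' (negbTE ndc) subn0.
  by apply: subseq_trans ss' (subseq_cons _ _).
subst d; exists c, (x :: s'); split=> /=; first by rewrite eqxx.
  by have := q_gt0 c; rewrite szs /q' eqxx; lia.
rewrite ps andbT; apply/allP => y /(mem_subseq ss).
by rewrite mem_filter => /andP[].
Qed.

Definition right_break n (g : adj n) i :=
  has (fun v => (i.+1 < v) && (ext g i v != ext g i.+1 v)) (iota 0 n).

Definition witness n (g : adj n) i :=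
  find (fun v => (i.+1 < v) && (ext g i v != ext g i.+1 v)) (iota 0 n).

Lemma witnessP n (g : adj n) i : right_break g i ->
  [/\ i.+1 < witness g i < n & ext g i (witness g i) != ext g i.+1 (witness g i)].
Proof.
move=> hb; have := nth_find 0 hb; have: witness g i < n.
  by rewrite -[n in _ < n](size_iota 0) -has_find.
by rewrite -/(witness g i) => hw; rewrite nth_iota // hw andbT => /andP[].
Qed.

(** Six order comparisons and eight adjacencies. The last bit depends on [t] only; it makes the
    adjacency of a break to its own witness constant. *)
Definition break_color n (g : adj n) (t s : nat) : 14.-tuple bool :=
  let w := witness g in
  [tuple t.+1 < s; w t < w s; w t == w s; w t < s; w t == s; w t == s.+1;
    ext g t (w s); ext g t.+1 (w s); ext g (w t) s; ext g (w t) s.+1;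
    ext g t s; ext g t.+1 s.+1; ext g (w t) (w s); ext g t (w t)].

(** Homogeneity turns comparisons and adjacencies into constants. Where constants disagree, one
    vertex separates many pairs; where they agree, a matching or half graph remains. The indices
    beyond [n] supply spare vertices. *)
Lemma fib_le_homogeneous (P : oprop) n N (g : adj N) (T : nat -> nat) (c : 14.-tuple bool) :
  hereditary P -> is_ograph g -> P N g ->
  (forall i j, i < j < n.+3 -> T i < T j) ->
  (forall i, i < n.+3 -> right_break g (T i)) ->
  (forall i j, i < j < n.+3 -> break_color g (T i) (T j) = c) ->
  fib n <= countP P n.
Proof.
move=> hP og Pg Tm Tb Tc.
pose E := ext g; pose V i := witness g (T i).
have VP i : i < n.+3 -> (T i).+1 < V i < N /\ E (T i) (V i) != E (T i).+1 (V i).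
  by move=> /Tb /witnessP[].
have [c0 c1 c2 [c3 c4 c5]] : [/\ exists c0, forall i j, i < j < n.+3 -> ((T i).+1 < T j) = c0,
    exists c1, forall i j, i < j < n.+3 -> (V i < V j) = c1,
    exists c2, forall i j, i < j < n.+3 -> (V i == V j) = c2 &
    [/\ exists c3, forall i j, i < j < n.+3 -> (V i < T j) = c3,
    exists c4, forall i j, i < j < n.+3 -> (V i == T j) = c4 &
    exists c5, forall i j, i < j < n.+3 -> (V i == (T j).+1) = c5]].
  split; last split; eexists => i j /Tc cij.
  - exact: (congr1 (fun c => nth false (val c) 0) cij).
  - exact: (congr1 (fun c => nth false (val c) 1) cij).
  - exact: (congr1 (fun c => nth false (val c) 2) cij).
  - exact: (congr1 (fun c => nth false (val c) 3) cij).
  - exact: (congr1 (fun c => nth false (val c) 4) cij).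
  - exact: (congr1 (fun c => nth false (val c) 5) cij).
have [[eav hav] [ebv hbv] [eva hva] [evb hvb]] : [/\
    exists e, forall i j, i < j < n.+3 -> E (T i) (V j) = e,
    exists e, forall i j, i < j < n.+3 -> E (T i).+1 (V j) = e,
    exists e, forall i j, i < j < n.+3 -> E (V i) (T j) = e &
    exists e, forall i j, i < j < n.+3 -> E (V i) (T j).+1 = e].
  split; eexists => i j /Tc cij.
  - exact: (congr1 (fun c => nth false (val c) 6) cij).
  - exact: (congr1 (fun c => nth false (val c) 7) cij).
  - exact: (congr1 (fun c => nth false (val c) 8) cij).
  - exact: (congr1 (fun c => nth false (val c) 9) cij).
have [[eaa haa] [ebb hbb] [evv hvv] [e0 he0]] : [/\
    exists e, forall i j, i < j < n.+3 -> E (T i) (T j) = e,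
    exists e, forall i j, i < j < n.+3 -> E (T i).+1 (T j).+1 = e,
    exists e, forall i j, i < j < n.+3 -> E (V i) (V j) = e &
    exists e, forall i, i < n.+2 -> E (T i) (V i) = e].
  split; eexists.
  - move=> i j /Tc cij; exact: (congr1 (fun c => nth false (val c) 10) cij).
  - move=> i j /Tc cij; exact: (congr1 (fun c => nth false (val c) 11) cij).
  - move=> i j /Tc cij; exact: (congr1 (fun c => nth false (val c) 12) cij).
  - move=> i hi; have cij := Tc i i.+1 ltac:(lia).
    exact: (congr1 (fun c => nth false (val c) 13) cij).
(* [T 1] lies between [T 0] and [T 2], so the inequality holds for the pair (0, 2), and homogeneity
   transfers it to all pairs. *)
have Tm1 i j : i < j < n.+3 -> (T i).+1 < T j.
  case: c0 => -[] h hij; rewrite ?h //.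
  have := h 0 2 ltac:(lia); have := Tm 0 1 ltac:(lia); have := Tm 1 2 ltac:(lia); lia.
(* [V 0] cannot meet both [T 1] and [T 2], nor both of their successors. *)
have [VT VT1] : (forall i j, i < j < n.+3 -> V i != T j) /\
    (forall i j, i < j < n.+3 -> V i != (T j).+1).
  have := Tm 1 2 ltac:(lia).
  split=> i j hij; [case: c4 => -[] h|case: c5 => -[] h]; rewrite ?h //;
   have := h 0 2 ltac:(lia); have := h 0 1 ltac:(lia); lia.
have TN i : i < n.+3 -> T i < N /\ (T i).+1 < N by move=> /VP[]; lia.
(* If all witnesses coincide, this one vertex separates every pair. *)
case: c2 => -[] hV.
  have VE i : i < n.+3 -> V i = V 0.
    by case: i => // i hi; apply/esym/eqP; apply: hV; lia.
  apply: (fib_le_alternating hP og Pg (A := T) (B := succn \o T) (v := V 0)).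
  - by have := VP 0 ltac:(lia); lia.
  - by move=> i hi /=; apply: TN; lia.
  - by move=> i j hij /=; have := Tm1 i j ltac:(lia); split; lia.
  - by move=> i hi /=; have := VP i ltac:(lia); rewrite VE; [case|lia].
  - by left=> i hi /=; have := VP i ltac:(lia); rewrite VE; lia.
(* If later witnesses separate earlier pairs, [V n] separates the first [n] pairs; next,
   symmetrically, [V 0] may separate the later pairs. *)
case: (eqVneq eav ebv) => [eab|nab]; last first.
  apply: (fib_le_alternating hP og Pg (A := T) (B := succn \o T) (v := V n)).
  - by have := VP n ltac:(lia); lia.
  - by move=> i hi /=; apply: TN; lia.
  - by move=> i j hij /=; have := Tm1 i j ltac:(lia); split; lia.
  - by move=> i hi /=; rewrite -/E hav ?hbv //; lia.
  - by left=> i hi /=; have := VP n ltac:(lia); have := Tm1 i n ltac:(lia); lia.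
case: (eqVneq eva evb) => [eba|nba]; last first.
  apply: (fib_le_alternating hP og Pg (A := T \o succn) (B := succn \o T \o succn) (v := V 0)).
  - by have := VP 0 ltac:(lia); lia.
  - by move=> i hi /=; apply: TN; lia.
  - by move=> i j hij /=; have := Tm1 i.+1 j.+1 ltac:(lia); split; lia.
  - move=> i hi /=; rewrite ![ext g _ (V 0)]ext_sym // -/E hva ?hvb //; lia.
  - case: c3 => -[] h3; [right|left] => i hi /=;
    have := h3 0 i.+1 ltac:(lia); have := VT 0 i.+1 ltac:(lia);
    have := VT1 0 i.+1 ltac:(lia); lia.
subst ebv evb.
(* [X i] is the vertex of the pair [T i], [T i + 1] whose adjacency to [V i] differs from the
   constant adjacency [eav] to later witnesses. *)
pose X i := T i + (e0 == eav).
have XT i : T i <= X i <= (T i).+1 by rewrite /X; lia.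
have X0 i : i < n.+2 -> E (X i) (V i) = ~~ eav.
  move=> hi; have [_] := VP i ltac:(lia); rewrite /X he0 //.
  case: (eqVneq e0 eav) => [->|h _] /=.
    by rewrite addn1; case: (eav); case: (E _ _).
  by rewrite addn0 he0 //; case: (e0) (eav) h => -[].
have XV i j : i < j < n.+3 -> E (X i) (V j) = eav.
  by move=> hij; rewrite /X; case: eqP => _ /=; rewrite ?addn1 ?addn0 ?hav ?hbv.
have VX i j : i < j < n.+3 -> E (V i) (X j) = eva.
  by move=> hij; rewrite /X; case: eqP => _ /=; rewrite ?addn1 ?addn0 ?hva ?hvb.
have [exx XX] : exists e, forall i j, i < j < n.+3 -> E (X i) (X j) = e.
  rewrite /X; case: eqP => _; [exists ebb|exists eaa] => i j hij;
  by rewrite /= ?addn1 ?addn0 ?haa ?hbb.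
have XltV i : i < n.+3 -> X i < V i < N.
  by move=> hi; have := XT i; have := VP i hi; lia.
have XltX i j : i < j < n.+3 -> X i < X j.
  by move=> hij; have := XT i; have := XT j; have := Tm1 i j hij; lia.
(* First the case where every [X i] precedes every [V j]: a matching or half graph between two
   intervals. *)
case: c3 => -[] h3; last first.
  have XV' i j : i < n.+3 -> j < n.+3 -> X i < V j.
    move=> hi hj; have := XltV i hi; have := XltV j hj.
    case: (ltngtP i j) => [hij|hij|-> //]; last by lia.
      by have := XltX i j ltac:(lia); lia.
    by have := h3 j i ltac:(lia); have := VT j i ltac:(lia);
       have := VT1 j i ltac:(lia); have := XT i; lia.
  case: c1 => c1 h1.
  apply: (fib_le_separated hP og Pg (X := X) (V := V) (a := eav) (b := eva) (d := ~~ c1)).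
  - by move=> i j hi hj; have := XltV j ltac:(lia); have := XV' i j; lia.
  - by move=> i j hij; apply: XltX; lia.
  - move=> i j hij; have := h1 i j ltac:(lia); have := hV i j ltac:(lia).
    by case: (c1) => /=; lia.
  - by move=> i hi; apply: X0; lia.
  - by move=> i j hij; apply: XV; lia.
  - by move=> i j hij; rewrite ext_sym //; apply: VX; lia.
(* Now [X 0 < V 0 < X 1 < V 1 < ...]. If [eav], [evv], [exx], [eva] are not all equal, then [V n],
   [X n] or [X 0] separates the pairs [X i], [V i]; otherwise a consecutive matching remains. *)
have VltX i j : i < j < n.+3 -> V i < X j.
  by move=> hij; have := h3 i j hij; have := XT j; lia.
have VltV i j : i < j < n.+3 -> V i < V j.
  by move=> hij; have := VltX i j hij; have := XltV j; lia.
have XltV' i j : i < j < n.+3 -> X i < V j.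
  by move=> hij; have := XltX i j hij; have := XltV j; lia.
have altl v : v < N -> (forall i, i < n -> X i < v /\ V i < v) ->
    (forall i, i < n -> E (X i) v != E (V i) v) -> fib n <= countP P n.
  move=> vN hv hE.
  apply: (fib_le_alternating hP og Pg (A := X) (B := V) vN) => //; last by left.
  - by move=> i hi; have := XltV i; lia.
  - by move=> i j hij; rewrite XltX ?VltX ?VltV ?XltV' //; lia.
case: (eqVneq eav evv) => [e1|ne1]; last first.
  apply: (altl (V n)) => [|i hi|i hi]; first by have := XltV n; lia.
    by rewrite XltV' ?VltV //; lia.
  by rewrite XV ?hvv //; lia.
case: (eqVneq exx eva) => [e2|ne2]; last first.
  apply: (altl (X n)) => [|i hi|i hi]; first by have := XltV n; lia.
    by rewrite XltX ?VltX //; lia.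
  by rewrite XX ?VX //; lia.
case: (eqVneq exx eav) => [e3|ne3]; last first.
  apply: (fib_le_alternating hP og Pg (A := X \o succn) (B := V \o succn) (v := X 0)).
  - by have := XltV 0; lia.
  - by move=> i hi /=; have := XltV i.+1; lia.
  - by move=> i j hij /=; rewrite XltX ?VltX ?VltV ?XltV' //; lia.
  - by move=> i hi /=; rewrite ![ext g _ (X 0)]ext_sym // -/E XX ?XV //; lia.
  - by right=> i hi /=; rewrite XltX ?XltV' //; lia.
apply: (fib_le_matching hP og Pg (X := X) (V := V) (a := eav)).
- by move=> i hi; apply: XltV; lia.
- by move=> i j hij; apply: VltX; lia.
- by move=> i hi; apply: X0; lia.
- by move=> i j hij; rewrite -e3; apply: XX; lia.
- by move=> i j hij; rewrite -e3 e2; apply: VX; lia.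
Qed.

Lemma right_breaks_bounded (P : oprop) n : hereditary P -> countP P n < fib n ->
  exists k, forall N (g : adj N) r, is_ograph g -> P N g ->
    count (right_break g) (iota 0 r) < k.
Proof.
move=> hP small.
have [k hk] := @ramsey (14.-tuple bool) _ (fun=> n.+3) (leqnn _).
exists k => N g r og Pg; rewrite ltnNge -size_filter; apply/negP => hs.
have [c [s [ss szs hom]]] := hk (break_color g) _ hs.
suff: fib n <= countP P n by rewrite leqNgt small.
have hs' : sorted ltn s.
  apply: (subseq_sorted ltn_trans ss); apply: sorted_filter; first exact: ltn_trans.
  exact: iota_ltn_sorted.
apply: (fib_le_homogeneous hP og Pg (T := nth 0 s) (c := c)) => [i j hij|i hi|i j hij].
- by apply: (sorted_ltn_nth ltn_trans); rewrite ?inE ?szs //; lia.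
- have : nth 0 s i \in s by rewrite mem_nth // szs.
  by move/(mem_subseq ss); rewrite mem_filter => /andP[].
- by apply/eqP; move/(pairwiseP 0): hom; apply; rewrite ?inE ?szs //; lia.
Qed.

(* Reversal turns witnesses to the left of a break into witnesses to its right. *)
Definition reverse n (g : adj n) : adj n := induced (@rev_ord n) g.

Definition reverse_prop (P : oprop) : oprop := fun n g => P n (reverse g).

Lemma reverseK n : involutive (@reverse n).
Proof. by move=> g; apply/ffunP=> -[i j]; rewrite !ffunE /= !rev_ordK. Qed.

Lemma is_ograph_induced m n (f : 'I_m -> 'I_n) (g : adj n) :
  is_ograph g -> is_ograph (induced f g).
Proof.
case/andP => /forallP h1 /forallP h2; apply/andP; split; apply/forallP=> i.
  by rewrite ffunE; apply: h1.
by apply/forallP=> j; rewrite !ffunE; apply: (forallP (h2 _)).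
Qed.

Lemma hereditary_reverse P : hereditary P -> hereditary (reverse_prop P).
Proof.
move=> hP n m g f og Pg fm; rewrite /reverse_prop.
have -> : reverse (induced f g) = induced (@rev_ord n \o f \o @rev_ord m) (reverse g).
  by apply/ffunP=> -[i j]; rewrite !ffunE /= !rev_ordK.
apply: (hP _ _ _ _ (is_ograph_induced _ og) Pg) => i j hij /=.
have : f (rev_ord j) < f (rev_ord i) by apply: fm => /=; have := ltn_ord j; lia.
by have := ltn_ord (f (rev_ord i)); lia.
Qed.

Lemma countP_reverse P n : countP (reverse_prop P) n <= countP P n.
Proof.
rewrite /countP -(card_image (can_inj (@reverseK n))); apply/subset_leq_card/subsetP.
by move=> _ /imageP[g /andP[og Pg] ->]; rewrite inE is_ograph_induced.
Qed.

Lemma ext_reverse n (g : adj n) i j : i < n -> j < n ->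
  ext (reverse g) (n.-1 - i) (n.-1 - j) = ext g i j.
Proof.
move=> hi hj.
have hi' : n.-1 - i < n by lia. have hj' : n.-1 - j < n by lia.
rewrite !ext_lt ffunE /=; congr (g (_, _)); apply: val_inj => /=; lia.
Qed.

Definition break n (g : adj n) i :=
  has (fun v => [&& v != i, v != i.+1 & ext g i v != ext g i.+1 v]) (iota 0 n).

Lemma breakP n (g : adj n) i : reflect
  (exists v, [/\ v < n, v != i, v != i.+1 & ext g i v != ext g i.+1 v]) (break g i).
Proof.
apply: (iffP hasP) => [[v]|[v [vn v1 v2 v3]]].
  by rewrite mem_iota => vn /and3P[]; exists v.
by exists v; rewrite ?mem_iota ?v1 ?v2.
Qed.

Lemma break_right n (g : adj n) i : i.+1 < n -> break g i ->
  right_break g i || right_break (reverse g) (n.-2 - i).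
Proof.
move=> hi /breakP[v [vn v1 v2 v3]]; apply/orP.
case: (ltnP i.+1 v) => hv.
  by left; apply/hasP; exists v; rewrite ?mem_iota // hv.
right; apply/hasP; exists (n.-1 - v); first by rewrite mem_iota; lia.
have -> : (n.-2 - i).+1 = n.-1 - i by lia.
have -> : n.-2 - i = n.-1 - i.+1 by lia.
rewrite !ext_reverse //; last by lia.
by rewrite eq_sym v3 andbT; lia.
Qed.

Lemma breaks_bounded (P : oprop) m : hereditary P -> countP P m < fib m ->
  exists k, forall n (g : adj n), is_ograph g -> P n g ->
    count (break g) (iota 0 n.-1) < k.
Proof.
move=> hP small.
have [k1 h1] := right_breaks_bounded hP small.
have [k2 h2] := right_breaks_bounded (hereditary_reverse hP)
  (leq_ltn_trans (countP_reverse P m) small).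
exists (k1 + k2) => n g og Pg.
have {}h1 := h1 n g n.-1 og Pg.
have {}h2 := h2 n (reverse g) n.-1 (is_ograph_induced _ og).
rewrite /reverse_prop reverseK in h2; have {Pg}h2 := h2 Pg.
(* Reversal sends a break at [i] to one at [n - 2 - i], a reflection that permutes the candidate
   positions. *)
have e : iota 0 n.-1 = rev [seq n.-2 - i | i <- iota 0 n.-1].
  apply: (@eq_from_nth _ 0) => [|i]; rewrite ?size_rev ?size_map ?size_iota // => hi.
  rewrite nth_rev ?size_map ?size_iota // (nth_map 0) ?size_iota; last by lia.
  by rewrite !nth_iota; lia.
rewrite e count_rev count_map in h2.
have : count (break g) (iota 0 n.-1) <= count (predU (right_break g)
    (fun i => right_break (reverse g) (n.-2 - i))) (iota 0 n.-1).
  rewrite -!size_filter.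
  have -> : filter (break g) (iota 0 n.-1) =
     filter (break g) (filter (predU (right_break g)
       (fun i => right_break (reverse g) (n.-2 - i))) (iota 0 n.-1)).
    rewrite -filter_predI; apply: eq_in_filter => i; rewrite mem_iota => hi /=.
    by case hb: (break g i) => //=; rewrite break_right //; lia.
  by rewrite [X in X <= _]size_filter count_size.
have := count_predUI (right_break g) (fun i => right_break (reverse g) (n.-2 - i))
  (iota 0 n.-1).
have {}h2 : count (fun i => right_break (reverse g) (n.-2 - i)) (iota 0 n.-1) < k2 := h2.
lia.
Qed.

(** * Eventually polynomial functions *)

Section EventuallyPolynomial.

Local Open Scope ring_scope.

Definition diff (f : nat -> int) n := f n.+1 - f n.

(** These are the functions that eventually agree with an integer-valued polynomial of degree less
    than [K]. *)
Fixpoint evpoly (K : nat) (f : nat -> int) : Prop :=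
  if K is K'.+1 then evpoly K' (diff f)
  else exists N, forall n, (N <= n)%N -> f n = 0.

Lemma evpoly_eventually_eq K f h :
  (exists N, forall n, (N <= n)%N -> f n = h n) -> evpoly K f -> evpoly K h.
Proof.
elim: K f h => [|K IH] f h [N e] /=.
  by case=> N' e0; exists (maxn N N') => n; rewrite geq_max => /andP[h1 h2]; rewrite -e ?e0.
by apply: IH; exists N => n hn; rewrite /diff !e //; lia.
Qed.

Lemma evpolyS K f : evpoly K f -> evpoly K.+1 f.
Proof.
elim: K f => [|K IH] f; last exact: IH.
by case=> N e; exists N => n hn; rewrite /diff !e ?subrr //; lia.
Qed.

Lemma evpoly_leq K K' f : (K <= K')%N -> evpoly K f -> evpoly K' f.
Proof.
move=> /subnK <- hf; elim: (_ - _)%N => // k; rewrite addSn; exact: evpolyS.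
Qed.

Lemma evpolyD K f h : evpoly K f -> evpoly K h -> evpoly K (fun n => f n + h n).
Proof.
elim: K f h => [|K IH] f h /=.
  move=> [N e] [N' e']; exists (maxn N N') => n.
  by rewrite geq_max => /andP[h1 h2]; rewrite e // e' // addr0.
move=> hf hh; apply: evpoly_eventually_eq (IH _ _ hf hh).
by exists 0%N => n _; rewrite /diff; ring.
Qed.

Lemma evpoly_shift K c f : evpoly K f -> evpoly K (fun n => f (n - c)%N).
Proof.
elim: K f => [|K IH] f /=.
  by case=> N e; exists (N + c)%N => n hn; rewrite e //; lia.
move=> /IH; apply: evpoly_eventually_eq.
by exists c => n hn; rewrite /diff subSn.
Qed.

(** Newton expansion: by Pascal's rule the difference of [C(n, i + 1)] is [C(n, i)], so the
    coefficients of [diff f] shift up by one, and the value at [N] fixes the new constant term. *)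
Lemma evpoly_binomial K f : evpoly K f ->
  exists N (a : nat -> int), forall n, (N <= n)%N ->
    f n = \sum_(i < K.+1) a i * ('C(n, i))%:Z.
Proof.
elim: K f => [|K IH] f /=.
  case=> N e; exists N, (fun=> 0) => n hn.
  by rewrite e // big1 // => i _; rewrite mul0r.
case/IH=> N [a e].
pose b i := if i is i'.+1 then a i' else f N - \sum_(i < K.+1) a i * ('C(N, i.+1))%:Z.
exists N, b => n /subnK <-; elim: (n - N)%N => {n} [|n IHn].
  rewrite big_ord_recl /= bin0 mulr1; under [X in _ + X]eq_bigr do rewrite /=.
  by rewrite subrK.
rewrite addSn -[LHS](subrK (f (n + N)%N)) -/(diff f (n + N)) e ?leq_addl // IHn.
rewrite [in RHS]big_ord_recl [X in _ + X = _]big_ord_recl /= !bin0 addrCA; congr (_ + _).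
rewrite -big_split /=; apply: eq_bigr => i _.
by rewrite /bump /= !add1n binS PoszD mulrDr addrC.
Qed.

End EventuallyPolynomial.

(** * Counting weak compositions under a stable condition *)

Fixpoint comps (l n : nat) : seq (seq nat) :=
  if l is l'.+1 then [seq c :: x | c <- iota 0 n.+1, x <- comps l' (n - c)]
  else if n == 0 then [:: [::]] else [::].

Lemma compsS l n : comps l.+1 n = [seq c :: x | c <- iota 0 n.+1, x <- comps l (n - c)].
Proof. by []. Qed.

Lemma mem_comps l n x : (x \in comps l n) = (size x == l) && (sumn x == n).
Proof.
elim: l n x => [|l IH] n x; last rewrite compsS.
  by case: n => [|n]; case: x => [|a x].
apply/allpairsPdep/andP => [[c [y [hc]]]|].
  rewrite IH mem_iota in hc * => /andP[/eqP <- /eqP hs] ->.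
  by rewrite /= eqxx; split=> //; lia.
case: x => [[]//|a x] [/eqP[hl] /eqP hs]; rewrite /= in hs.
by exists a, x; rewrite mem_iota IH hl eqxx; split=> //; lia.
Qed.

Lemma uniq_comps l n : uniq (comps l n).
Proof.
elim: l n => [|l IH] n; first by rewrite /=; case: ifP.
rewrite compsS.
by apply: allpairs_uniq_dep => [|c _|[c x] [d y] _ _ /= [-> ->]]; rewrite ?iota_uniq.
Qed.

Definition stable l M (D : seq nat -> Prop) :=
  forall x, size x = l -> D x <-> D (map (minn M) x).

Lemma stable_leq l M M' D : M <= M' -> stable l M D -> stable l M' D.
Proof.
move=> hM st x sx; rewrite (st x) // (st (map (minn M') x)) ?size_map // -map_comp.
by rewrite (@eq_map _ _ _ (minn M)) // => a /=; lia.
Qed.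

(** Induction on the number of parts. First parts [c < M] contribute finitely many shifted counts;
    first parts [c >= M] all impose the condition of [c = M], so together they give a partial sum of
    a single count. *)
Lemma stable_count_evpoly l M (Q : pred (seq nat)) : stable l M Q ->
  exists K, evpoly K (fun n => (count Q (comps l n))%:Z)%R.
Proof.
elim: l Q => [|l IH] Q st.
  by exists 0, 1 => -[].
have IHc c : exists K, evpoly K (fun n => (count (Q \o cons c) (comps l n))%:Z)%R.
  apply: IH => x sx; split => /st /=; rewrite ?size_map ?sx => /(_ erefl) h.
    apply/st => /=; first by rewrite size_map sx.
    by rewrite -map_comp (@eq_map _ _ _ (minn M)) // => a /=; lia.
  apply/st => /=; first by rewrite sx.
  by rewrite -map_comp (@eq_map _ _ _ (minn M)) // in h => a /=; lia.
pose h c n := (count (Q \o cons c) (comps l n))%:Z%R.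
pose S n := (\sum_(j < n.+1) h M j)%R.
have [K1 hS] : exists K, evpoly K (fun n => S (n - M)).
  have [K hK] := IHc M; exists K.+1; apply: evpoly_shift => /=.
  (* The difference of [S] is the count at [n + 1], which is the count at [n] plus its own
     difference. *)
  apply: evpoly_eventually_eq (evpolyD hK (evpolyS hK : evpoly K (diff _))).
  exists 0 => n _; rewrite /diff /S [in RHS]big_ord_recr /= /h; ring.
have [K2 hs] : exists K, evpoly K (fun n => \sum_(0 <= c < M) h c (n - c)%N)%R.
  elim: (M) => [|m [K hK]].
    by exists 0, 0 => n _; rewrite big_geq.
  have [K' hK'] := IHc m; exists (maxn K K').
  have := evpolyD (evpoly_leq (leq_maxl K K') hK)
    (evpoly_shift m (evpoly_leq (leq_maxr K K') hK')).
  by apply: evpoly_eventually_eq; exists 0 => n _; rewrite big_nat_recr.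
exists (maxn K1 K2).
have := evpolyD (evpoly_leq (leq_maxr K1 K2) hs) (evpoly_leq (leq_maxl K1 K2) hS).
apply: evpoly_eventually_eq; exists M => n hn.
have -> : (count Q (comps l.+1 n))%:Z%R = (\sum_(0 <= c < n.+1) h c (n - c)%N)%R.
  rewrite compsS count_flatten sumnE !big_map -/(index_iota 0 n.+1).
  rewrite (big_morph Posz PoszD (erefl _)).
  by apply: eq_bigr => c _; rewrite count_map /h.
rewrite [RHS](@big_cat_nat _ _ _ M) //=; last by lia.
congr (_ + _)%R; rewrite /S.
have -> : (\sum_(M <= c < n.+1) h c (n - c)%N = \sum_(i < (n - M).+1) h (i + M)%N (n - (i + M))%N)%R.
  by rewrite -{1}[M]add0n big_addn big_mkord subSn.
rewrite (reindex_inj rev_ord_inj) /=; apply: eq_bigr => i _.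
have hi := ltn_ord i; have -> : n - (i + M) = (n - M).+1 - i.+1 by lia.
rewrite /h; congr (Posz _); apply: eq_in_count => x.
rewrite mem_comps => /andP[/eqP sx _] /=.
apply/idP/idP => /st /=; rewrite sx => /(_ erefl) H; apply/st => //=; rewrite ?sx //.
  by move: H; congr (is_true (Q (_ :: _))); lia.
by move: H; congr (is_true (Q (_ :: _))); lia.
Qed.

(* Dickson's lemma. *)
Lemma stable_downset l (D : seq nat -> Prop) :
  (forall x y, size x = l -> size y = l -> (forall i, nth 0 x i <= nth 0 y i) -> D y -> D x) ->
  exists M, stable l M D.
Proof.
elim: l D => [|l IH] D down.
  by exists 0 => -[].
(* The tails that stay in [D] under arbitrarily large first entries. *)
pose I x := forall c, D (c :: x).
have downc c x y : size x = l -> size y = l -> (forall i, nth 0 x i <= nth 0 y i) ->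
    D (c :: y) -> D (c :: x).
  by move=> sx sy h; apply: down; rewrite /= ?sx ?sy // => -[|i] /=.
have downh c d x : size x = l -> c <= d -> D (d :: x) -> D (c :: x).
  by move=> sx h; apply: down; rewrite /= ?sx // => -[|i] /=.
have [M0 st0] : exists M, stable l M I.
  by apply: IH => x y sx sy h Iy c; apply: downc (Iy c).
(* A single threshold suffices: only finitely many tails have all entries at most [M0], and each of
   them outside [I] is already lost at some first entry. *)
have [M1 hM1] : exists M1, forall y, size y = l -> (forall a, a \in y -> a <= M0) ->
    D (M1 :: y) -> I y.
  have [M1 hM1] : exists M1, forall y,
      y \in flatten [seq comps l n | n <- iota 0 (l * M0).+1] -> D (M1 :: y) -> I y.
    have : all (fun y => size y == l) (flatten [seq comps l n | n <- iota 0 (l * M0).+1]).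
      by apply/allP=> y /flatten_mapP[n _]; rewrite mem_comps => /andP[].
    elim: flatten => [|y s IHs] /= => [_|/andP[/eqP sy hs]]; first by exists 0.
    have [m1 h1] := IHs hs.
    have [m2 h2] : exists m, D (m :: y) -> I y.
      case: (classic (I y)) => [Iy|]; first by exists 0.
      by case/not_all_ex_not => m hm; exists m.
    exists (maxn m1 m2) => z; rewrite inE => /orP[/eqP->|hz] hD.
      by apply: h2; apply: downh hD => //; lia.
    apply: h1 => //; apply: downh hD; last by lia.
    by apply/eqP; apply: (allP hs).
  exists M1 => y sy hy; apply: hM1; apply/flatten_mapP; exists (sumn y).
    rewrite mem_iota /= add0n ltnS -sy; elim: y hy {sy} => //= a y IHy hy.
    rewrite mulSn leq_add ?hy ?mem_head //; apply: IHy => b hb.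
    by apply: hy; rewrite inE hb orbT.
  by rewrite mem_comps sy !eqxx.
have [M2 st2] : exists M2, forall c, c < M1 -> stable l M2 (fun x => D (c :: x)).
  elim: (M1) => [|m [M2 h2]]; first by exists 0.
  have [M3 h3] := IH (fun x => D (m :: x)) (downc m).
  exists (maxn M2 M3) => c; rewrite ltnS leq_eqVlt => /orP[/eqP->|hc].
    by apply: stable_leq h3; lia.
  by apply: stable_leq (h2 c hc); lia.
(* The tail truncated at [M0] lies in the slice of [M1], hence in [I], and by stability of [I] so
   does the tail. *)
have large c x : size x = l -> M1 <= c -> D (c :: x) <-> I x.
  move=> sx hc; split=> [hD|]; last by apply.
  apply/st0 => //; apply: hM1; first by rewrite size_map.
    by move=> _ /mapP[b _ ->]; lia.
  apply: (downh _ c); rewrite ?size_map //; apply: (downc c _ x) => // [|i].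
    by rewrite size_map.
  case: (ltnP i (size x)) => hi; first by rewrite (nth_map 0) //; lia.
  by rewrite !nth_default ?size_map.
exists (maxn M0 (maxn M1 M2)) => -[//|c x] /= [sx].
set M := maxn _ _.
case: (ltnP c M1) => hc.
  have -> : minn M c = c by lia.
  have le2 : M2 <= M by lia.
  exact: (stable_leq le2 (st2 c hc)).
rewrite !large ?size_map //; last by lia.
have le0 : M0 <= M by lia.
exact: (stable_leq le0 st0).
Qed.

(** * Graphs with few breaks *)

Fixpoint block_word (c : nat) (x : seq nat) : seq nat :=
  if x is a :: x' then nseq a c ++ block_word c.+1 x' else [::].

Lemma size_block_word c x : size (block_word c x) = sumn x.
Proof. by elim: x c => //= a x IH c; rewrite size_cat size_nseq IH. Qed.

Lemma block_word_ge c x v : v \in block_word c x -> c <= v < c + size x.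
Proof.
elim: x c => //= a x IH c; rewrite mem_cat => /orP[|/IH]; last by lia.
by rewrite mem_nseq => /andP[_ /eqP->]; lia.
Qed.

Lemma count_block_word c x d : count_mem (c + d) (block_word c x) = nth 0 x d.
Proof.
elim: x c d => [|a x IH] c d /=; first by rewrite nth_nil.
rewrite count_cat count_nseq /=; case: d => [|d] /=.
  rewrite addn0 eqxx mul1n; have -> : count_mem c (block_word c.+1 x) = 0.
    by apply/count_memPn/negP => /block_word_ge; lia.
  by rewrite addn0.
have -> : (c == c + d.+1) = false by lia.
by rewrite mul0n add0n addnS -addSn IH.
Qed.

Lemma sorted_block_word c x : sorted leq (block_word c x).
Proof.
elim: x c => //= a x IH c.
rewrite (sorted_pairwise leq_trans) pairwise_cat -!(sorted_pairwise leq_trans) IH andbT.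
apply/andP; split.
  by apply/allrelP => u v; rewrite mem_nseq => /andP[_ /eqP->] /block_word_ge; lia.
by rewrite (sorted_pairwise leq_trans); elim: a => //= a ->; rewrite andbT all_nseq leqnn orbT.
Qed.

Definition unit_step : rel nat := fun a b => (b == a) || (b == a.+1).

(** With nonempty blocks the word climbs one letter at a time, so labels can be recovered by
    counting changes of letter. *)
Lemma block_word_steps c x : all (leq 1) x -> x != [::] ->
  exists r, [/\ block_word c x = c :: r, path unit_step c r & last c r = c + (size x).-1].
Proof.
elim: x c => // -[//|a] x IH c /= hx _.
have p : path unit_step c (nseq a c).
  by elim: a => //= a ->; rewrite /unit_step eqxx.
have l : last c (nseq a c) = c by elim: a {p} => //= a; case: a.
case: x IH hx => [|b x] IH hx.
  by exists (nseq a c); rewrite /= cats0 addn0.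
have [r [-> pr lr]] := IH c.+1 hx isT.
exists (nseq a c ++ c.+1 :: r); split=> //.
  by rewrite cat_path p l /= {1}/unit_step eqxx orbT.
by rewrite last_cat /= lr /= addSnnS.
Qed.

Lemma subseq_block_word c x y : size x = size y ->
  (forall i, nth 0 x i <= nth 0 y i) -> subseq (block_word c x) (block_word c y).
Proof.
elim: x y c => [|a x IH] [|b y] //= c [sxy] h.
apply: cat_subseq; last by apply: IH => // i; apply: (h i.+1).
have /= /subnK <- := h 0; rewrite nseqD; exact: suffix_subseq.
Qed.

Lemma subseq_index s1 s2 : subseq s1 s2 -> exists f : nat -> nat,
  (forall i j, i < j < size s1 -> f i < f j) /\
  (forall i, i < size s1 -> f i < size s2 /\ nth 0 s2 (f i) = nth 0 s1 i).
Proof.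
case/subseqP=> m sm ->.
have e : mask m s2 = map (nth 0 s2) (mask m (iota 0 (size s2))).
  by rewrite map_mask map_nth_iota0 // take_size.
have sI : size (mask m s2) = size (mask m (iota 0 (size s2))).
  by rewrite e size_map.
have srt : sorted ltn (mask m (iota 0 (size s2))).
  by apply: (subseq_sorted ltn_trans (mask_subseq _ _)); apply: iota_ltn_sorted.
exists (nth 0 (mask m (iota 0 (size s2)))); split=> [i j hij|i hi].
  by apply: (sorted_ltn_nth ltn_trans) => //; rewrite ?inE -?sI; lia.
split; last by rewrite e (nth_map 0) // -sI.
have : nth 0 (mask m (iota 0 (size s2))) i \in iota 0 (size s2).
  by apply: (mem_subseq (mask_subseq m _)); rewrite mem_nth // -sI.
by rewrite mem_iota.
Qed.

(* [blowup T w] replaces the vertex [c] of [T] by as many vertices as [w] has letters [c];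
   a loop at [c] in [T] makes them a clique. *)
Definition blowup L (T : adj L) (w : seq nat) n : adj n :=
  [ffun p : 'I_n * 'I_n => (p.1 != p.2) && ext T (nth 0 w p.1) (nth 0 w p.2)].

Lemma ext_blowup L (T : adj L) w n i j : i < n -> j < n ->
  ext (blowup T w n) i j = (i != j) && ext T (nth 0 w i) (nth 0 w j).
Proof. by move=> hi hj; rewrite ext_lt ffunE. Qed.

Definition sym_adj L (T : adj L) := forall i j, ext T i j = ext T j i.

Lemma is_ograph_blowup L (T : adj L) w n : sym_adj T -> is_ograph (blowup T w n).
Proof.
move=> sT; apply/andP; split; apply/forallP=> i; first by rewrite ffunE /= eqxx.
by apply/forallP=> j; rewrite !ffunE /= [i == j]eq_sym (sT (nth 0 w i)).
Qed.

(** Shrinking blocks deletes letters of the block word, which amounts to taking an induced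
    subgraph. *)
Lemma blowup_downset (P : oprop) L (T : adj L) l x y : hereditary P -> sym_adj T ->
  size x = l -> size y = l -> (forall i, nth 0 x i <= nth 0 y i) ->
  P (sumn y) (blowup T (block_word 0 y) (sumn y)) ->
  P (sumn x) (blowup T (block_word 0 x) (sumn x)).
Proof.
move=> hP sT sx sy hxy Py.
have [|f [fm fE]] := subseq_index (subseq_block_word 0 _ hxy).
  by rewrite sx sy.
rewrite !size_block_word in fm fE.
have fN (i : 'I_(sumn x)) : f i < sumn y by case: (fE i (ltn_ord i)).
suff -> : blowup T (block_word 0 x) (sumn x) =
    induced (fun i => Ordinal (fN i)) (blowup T (block_word 0 y) (sumn y)).
  apply: (hP _ _ _ _ (is_ograph_blowup _ _ sT) Py) => i j hij /=.
  by apply: fm; rewrite hij /=.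
apply/ffunP=> -[i j]; rewrite !ffunE /=.
have [_ ->] := fE i (ltn_ord i); have [_ ->] := fE j (ltn_ord j).
congr (_ && _); rewrite -!val_eqE /=.
case: (ltngtP i j) => [h|h|->]; last by rewrite eqxx.
  by have := fm i j; rewrite h ltn_ord => /(_ isT); lia.
by have := fm j i; rewrite h ltn_ord => /(_ isT); lia.
Qed.

(** * Decomposition into blocks, with the index of its block as the label of a vertex *)

Definition label n (g : adj n) i := count (break g) (iota 0 i).

Lemma labelS n (g : adj n) i : label g i.+1 = label g i + break g i.
Proof. by rewrite /label -addn1 iotaD count_cat /= addn0. Qed.

Lemma label_leq n (g : adj n) i j : i <= j -> label g i <= label g j.
Proof.
by move=> /subnK <-; elim: (j - i) => // k IH; rewrite addSn labelS; lia.
Qed.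

(** A discrete intermediate value argument: labels start at 0 and grow by at most 1, only at
    breaks. *)
Lemma label_cross n (g : adj n) c i : c < label g i ->
  exists2 j, j < i & label g j = c /\ break g j.
Proof.
elim: i => [|i IH]; first by [].
rewrite labelS => hc; case: (ltnP c (label g i)) => [/IH[j hj H]|h].
  by exists j => //; lia.
by exists i => //; case: (break g i) hc; lia.
Qed.

(* Moving from i to i' one vertex at a time fails when j is met; there the edge
   {i, j} is first replaced by {i, j+1}. *)
Lemma label_eq_adj1 n (g : adj n) i i' j : is_ograph g -> i < n -> i' < n -> j < n ->
  label g i = label g i' -> i != j -> i' != j -> ext g i j = ext g i' j.
Proof.
move=> og; wlog: i i' / i <= i'.
  move=> W hi hi' hj e h h'; case: (leqP i i') => hii; first exact: W.
  by apply/esym/W => //; apply: ltnW.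
move=> /subnK <-; elim: (i' - i) j => {i'} // k IH j hi; rewrite !addSn.
set m := k + i in IH * => hm hj e hij hmj.
have le1 : label g i <= label g m by apply: label_leq; rewrite /m; lia.
have := labelS g m => es.
have nb v : v < n -> v != m -> v != m.+1 -> ext g m v = ext g m.+1 v.
  move=> hv h1 h2; apply/eqP/negPn/negP => hne.
  by have : break g m; [apply/breakP; exists v|lia].
have em : label g i = label g m by lia.
case: (eqVneq m j) => [mj|nmj]; last first.
  by rewrite IH //; [apply: nb; lia | lia].
have him : i != m by rewrite mj.
rewrite -mj [LHS](ext_sym _ _ og) (nb i) //; try lia.
rewrite [LHS](ext_sym _ _ og) IH //; try lia.
exact: (ext_sym _ _ og).
Qed.

Lemma label_eq_adj n (g : adj n) i i' j j' : is_ograph g ->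
  i < n -> i' < n -> j < n -> j' < n ->
  label g i = label g i' -> label g j = label g j' -> i != j -> i' != j' ->
  ext g i j = ext g i' j'.
Proof.
move=> og hi hi' hj hj' ei ej hij hij'.
have step1 a b c : a < n -> b < n -> c < n -> label g a = label g b ->
    a != c -> b != c -> ext g a c = ext g b c by move=> *; apply: label_eq_adj1.
have step2 a b c : a < n -> b < n -> c < n -> label g a = label g b ->
    a != c -> b != c -> ext g c a = ext g c b.
  by move=> *; rewrite ![ext g c _](ext_sym _ _ og); apply: label_eq_adj1.
(* One endpoint moves at a time. If [i' = j], moving [i] first would create a loop, so [j] moves
   first. *)
case: (eqVneq i' j) => [e|nij].
  subst j; case: (eqVneq i j') => [<-|nij']; first exact: ext_sym.
  by rewrite (step2 i' j') // 1?eq_sym // (step1 i i') // eq_sym.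
by rewrite (step1 i i') // (step2 j j') // eq_sym.
Qed.

Definition num_blocks n (g : adj n) := if n is n'.+1 then (label g n').+1 else 0.

(** By [label_eq_adj] all pairs of distinct vertices from two given blocks agree, so one edge
    decides the entry. The common size [L] puts the types of graphs of all orders into one finite
    type. *)
Definition block_type L n (g : adj n) : adj L :=
  [ffun p : 'I_L * 'I_L => [exists i : 'I_n, exists j : 'I_n,
     [&& i != j, label g i == p.1, label g j == p.2 & g (i, j)]]].

Definition block_sizes n (g : adj n) : seq nat :=
  mkseq (fun c => #|[pred i : 'I_n | label g i == c]|) (num_blocks g).

Lemma label_lt n (g : adj n) i : i < n -> label g i < num_blocks g.
Proof. by case: n g => // n g hi; rewrite /num_blocks ltnS; apply: label_leq. Qed.

Lemma ext_block_typeP L n (g : adj n) c d : reflect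
  (exists i j, [/\ c < L, d < L, i < n, j < n & [/\ i != j, label g i = c, label g j = d & ext g i j]])
  (ext (block_type L g) c d).
Proof.
apply: (iffP idP) => [|[i [j [hc hd hi hj [nij ei ej gij]]]]].
  case: (boolP ((c < L) && (d < L))) => [/andP[hc hd]|h]; last by rewrite ext_default.
  rewrite ext_lt ffunE => /existsP[i /existsP[j /and4P[nij /eqP ei /eqP ej gij]]].
  by exists i, j; rewrite extE.
rewrite ext_lt ffunE; apply/existsP; exists (Ordinal hi); apply/existsP; exists (Ordinal hj).
by rewrite -val_eqE /= nij ei ej !eqxx -ext_lt.
Qed.

Lemma ext_block_type L n (g : adj n) i j : is_ograph g -> num_blocks g <= L ->
  i < n -> j < n -> i != j -> ext (block_type L g) (label g i) (label g j) = ext g i j.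
Proof.
move=> og hL hi hj nij; apply/ext_block_typeP/idP.
  case=> i' [j' [_ _ hi' hj' [nij' ei ej]]].
  by rewrite (@label_eq_adj _ g i' i j' j).
by move=> gij; exists i, j; split=> //; apply: leq_trans (label_lt _ _) hL.
Qed.

Lemma size_block_sizes n (g : adj n) : size (block_sizes g) = num_blocks g.
Proof. exact: size_mkseq. Qed.

Lemma nth_block_sizes n (g : adj n) c :
  nth 0 (block_sizes g) c = #|[pred i : 'I_n | label g i == c]|.
Proof.
case: (ltnP c (num_blocks g)) => hc; first by rewrite nth_mkseq.
rewrite nth_default ?size_block_sizes //; apply/esym/eq_card0 => i; rewrite !inE.
by have := label_lt g (ltn_ord i); lia.
Qed.

Lemma count_mem_ord (w : seq nat) n c : size w = n ->
  count_mem c w = #|[pred i : 'I_n | nth 0 w i == c]|.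
Proof.
move=> sw; rewrite -[w in LHS](mkseq_nth 0) sw count_map cardE /enum_mem -enumT /=.
by rewrite size_filter -val_enum_ord count_map; apply: eq_count.
Qed.

(** Both words are sorted and contain each letter equally often. *)
Lemma block_word_sizes n (g : adj n) :
  block_word 0 (block_sizes g) = mkseq (label g) n.
Proof.
apply: (sorted_eq leq_trans anti_leq); first exact: sorted_block_word.
  apply/(sortedP 0) => i; rewrite size_mkseq => hi; rewrite !nth_mkseq //; last by lia.
  exact: label_leq.
apply/allP => c _; apply/eqP; rewrite -[c in LHS]add0n count_block_word nth_block_sizes.
rewrite (@count_mem_ord _ n) ?size_mkseq //; apply: eq_card => i.
by rewrite !inE nth_mkseq.
Qed.

Lemma sumn_block_sizes n (g : adj n) : sumn (block_sizes g) = n.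
Proof. by rewrite -(size_block_word 0) block_word_sizes size_mkseq. Qed.

Lemma blowup_block_type L n (g : adj n) : is_ograph g -> num_blocks g <= L ->
  blowup (block_type L g) (block_word 0 (block_sizes g)) n = g.
Proof.
move=> og hL; apply: adj_eq => i j hi hj; rewrite ext_blowup // block_word_sizes !nth_mkseq //.
case: eqVneq => [<-|nij] /=; last exact: ext_block_type.
by rewrite ext_lt; case/andP: og => /forallP/(_ (Ordinal hi))/negbTE.
Qed.

(* The conditions under which T and x are recovered from the blow-up: blocks are
   nonempty, entries of T that the blow-up does not see are false, and every block
   boundary is a break. *)
Definition canonical l L (T : adj L) (x : seq nat) : bool :=
  [&& all (leq 1) x,
      [forall c : 'I_L, forall d : 'I_L, T (c, d) == T (d, c)],
      [forall c : 'I_L, forall d : 'I_L, T (c, d) ==> (c < l) && (d < l)],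
      [forall c : 'I_L, T (c, c) ==> (1 < nth 0 x c)]
    & [forall c : 'I_L, (c.+1 < l) ==> [exists d : 'I_L,
        [&& d < l, ext T c d != ext T c.+1 d,
            (d == c :> nat) ==> (1 < nth 0 x c)
          & (d == c.+1 :> nat) ==> (1 < nth 0 x c.+1)]]]].

Lemma canonical_sym l L (T : adj L) x : canonical l T x -> sym_adj T.
Proof.
case/and5P=> _ /forallP sT _ _ _ i j.
rewrite /ext; case: insubP => [a _ _|_]; case: insubP => [b _ _|_] //.
by apply/eqP/(forallP (sT a)).
Qed.

(** The conditions only ask whether an entry is at least 1 or at least 2. *)
Lemma canonical_truncate l L (T : adj L) x :
  canonical l T x = canonical l T (map (minn 2) x).
Proof.
have h c : (1 < nth 0 (map (minn 2) x) c) = (1 < nth 0 x c).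
  case: (ltnP c (size x)) => hc; first by rewrite (nth_map 0) //; lia.
  by rewrite !nth_default ?size_map.
rewrite /canonical all_map; congr [&& _, _, _, _ & _].
- by apply: eq_all => a /=; lia.
- by apply: eq_forallb => c; rewrite h.
- by apply: eq_forallb => c; congr (_ ==> _); apply: eq_existsb => d; rewrite !h.
Qed.

Lemma canonical_block_type L n (g : adj n) : is_ograph g -> num_blocks g <= L ->
  canonical (num_blocks g) (block_type L g) (block_sizes g).
Proof.
move=> og hL.
have two i j c : i < n -> j < n -> i != j -> label g i = c -> label g j = c ->
    1 < nth 0 (block_sizes g) c.
  move=> hi hj nij ei ej; rewrite nth_block_sizes; apply/card_gt1P.
  by exists (Ordinal hi), (Ordinal hj); rewrite !inE /= ei ej -val_eqE.
apply/and5P; split.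
- apply/(all_nthP 0) => c; rewrite size_block_sizes => hc; rewrite nth_block_sizes.
  apply/card_gt0P; case: n g og hL two hc => // n g og hL two.
  rewrite /num_blocks ltnS leq_eqVlt => /orP[/eqP->|/label_cross[j hj [ej _]]].
    by exists ord_max; rewrite inE.
  have hj' : j < n.+1 by lia.
  by exists (Ordinal hj'); rewrite inE /= ej.
- apply/forallP=> c; apply/forallP=> d; rewrite -!extE; apply/eqP.
  by apply/ext_block_typeP/ext_block_typeP => -[i [j [? ? ? ? [nij ei ej gij]]]];
    exists j, i; rewrite eq_sym (ext_sym _ _ og).
- apply/forallP=> c; apply/forallP=> d; apply/implyP; rewrite -extE.
  by case/ext_block_typeP=> i [j [_ _ hi hj [_ <- <- _]]]; rewrite !label_lt.
- apply/forallP=> c; apply/implyP; rewrite -extE.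
  by case/ext_block_typeP=> i [j [_ _ hi hj [nij ei ej _]]]; apply: two hi hj nij ei ej.
- apply/forallP=> c; apply/implyP => hc.
  (* The boundary after block [c] is a break at some [i]; the label of a vertex [v] separating [i]
     from [i + 1] serves as [d]. If [v] shares the block of one of them, that block has two
     vertices. *)
  have [i [hi ei bi]] : exists i, [/\ i.+1 < n, label g i = c & break g i].
    case: n g hc {og hL two} => // n g; rewrite /num_blocks ltnS.
    by case/label_cross=> i hi [ei bi]; exists i; rewrite ltnS.
  have ei1 : label g i.+1 = c.+1 by rewrite labelS ei bi addn1.
  case/breakP: (bi) => v [hv v1 v2 v3].
  have hvL : label g v < L by apply: leq_trans (label_lt _ _) hL.
  apply/existsP; exists (Ordinal hvL) => /=; rewrite label_lt //= -ei1 -ei.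
  have hi' : i < n by lia.
  rewrite (ext_block_type og hL hi') // 1?[i == v]eq_sym //.
  rewrite (ext_block_type og hL hi) // 1?[i.+1 == v]eq_sym //.
  rewrite v3 /=; apply/andP; split; apply/implyP => /eqP e.
    by apply: (two v i); rewrite //; lia.
  by apply: (two v i.+1).
Qed.

(** * Recovering type and sizes from a canonical blow-up *)

Section Canonical.

Variables (l L : nat) (T : adj L) (x : seq nat) (n : nat).
Hypotheses (lL : l <= L) (sx : size x = l) (nx : sumn x = n) (can : canonical l T x).
Let w := block_word 0 x.
Let g := blowup T w n.

Let sw : size w = n. Proof. by rewrite size_block_word. Qed.

Let og : is_ograph g. Proof. exact/is_ograph_blowup/(canonical_sym can). Qed.

Let wl i : i < n -> nth 0 w i < l.
Proof.
by move=> hi; have /block_word_ge : nth 0 w i \in w; rewrite ?mem_nth ?sw ?sx.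
Qed.

Let card_w c : #|[pred i : 'I_n | nth 0 w i == c]| = nth 0 x c.
Proof. by rewrite -(count_mem_ord _ sw) -[c in LHS]add0n count_block_word. Qed.

Let w_ex c : c < l -> exists2 i, i < n & nth 0 w i = c.
Proof.
move=> hc; case/and5P: can => /(all_nthP 0) /(_ c); rewrite sx => /(_ hc) h _ _ _ _.
rewrite -card_w in h; case/card_gt0P: h => i; rewrite inE => /eqP e.
by exists i.
Qed.

Let w_ex2 c j : 1 < nth 0 x c -> exists i, [/\ i < n, i != j & nth 0 w i = c].
Proof.
rewrite -card_w => /card_gt1P[a [b []]]; rewrite !inE => /eqP ea /eqP eb; rewrite -val_eqE /=.
by case: (eqVneq (a : nat) j) => [e|ne] nab; [exists b; rewrite -e eq_sym | exists a].
Qed.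

Let w_steps : 0 < n -> [/\ nth 0 w 0 = 0, nth 0 w n.-1 = l.-1 &
  forall i, i.+1 < n -> unit_step (nth 0 w i) (nth 0 w i.+1)].
Proof.
move=> n0; have xn : x != [::] by apply: contraTneq n0 => x0; rewrite -nx x0.
case/and5P: can => xpos _ _ _ _.
have [r [e p lst]] := block_word_steps 0 xpos xn.
split; first by rewrite /w e.
  by rewrite -sw nth_last /w e /= lst sx.
have : sorted unit_step w by rewrite /w e.
by move/(sortedP 0) => h i; rewrite -sw; apply: h.
Qed.

(** Vertices with the same letter are twins. Where the letter changes, canonicity yields a
    separating letter [d], and its size conditions guarantee a vertex of letter [d] other than [i]
    and [i + 1]. *)
Let break_w i : i.+1 < n -> break g i = (nth 0 w i != nth 0 w i.+1).
Proof.
move=> hi; have [_ _ /(_ i hi)] := w_steps ltac:(lia); rewrite /unit_step => st.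
have hi' : i < n by lia.
apply/breakP/idP => [[v [hv v1 v2]]|ne].
  by rewrite !ext_blowup // ![_ == v]eq_sym v1 v2 /=; apply: contraNneq => ->.
have {ne st} st : nth 0 w i.+1 = (nth 0 w i).+1 by lia.
have hc : nth 0 w i < L by apply: leq_trans (wl hi') lL.
have hc1 : (nth 0 w i).+1 < l by rewrite -st wl.
case/and5P: can => _ _ _ _ /forallP /(_ (Ordinal hc)) /=; rewrite hc1 /=.
case/existsP=> d /and4P[hd nd /implyP d1 /implyP d2].
suff [v [hv v1 v2 ev]] : exists v, [/\ v < n, v != i, v != i.+1 & nth 0 w v = d].
  by exists v; split=> //; rewrite !ext_blowup // ![_ == v]eq_sym v1 v2 /= ev st.
case: (eqVneq (d : nat) (nth 0 w i)) => [e|ne1].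
  have [v [hv v1 ev]] := w_ex2 i (d1 (introT eqP e)).
  exists v; split=> //; last by rewrite ev.
  by apply/eqP => e'; move: ev; rewrite e'; lia.
case: (eqVneq (d : nat) (nth 0 w i).+1) => [e|ne2].
  have [v [hv v1 ev]] := w_ex2 i.+1 (d2 (introT eqP e)).
  exists v; split=> //; last by rewrite ev.
  by apply/eqP => e'; move: ev; rewrite e'; lia.
have [v hv ev] := w_ex hd.
by exists v; split=> //; apply/eqP => e; move: ev; rewrite e => ev; move: ne1 ne2; lia.
Qed.

Let label_w i : i < n -> label g i = nth 0 w i.
Proof.
elim: i => [|i IH] hi; first by have [-> _ _] := w_steps hi.
have [_ _ /(_ i hi)] := w_steps ltac:(lia); rewrite /unit_step => st.
by rewrite labelS break_w // IH; lia.
Qed.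

Lemma num_blocks_blowup : num_blocks g = l.
Proof.
rewrite /num_blocks; case en: n g label_w => [|m] g' lab.
  rewrite -sx; case: x nx can => // a x'; rewrite en /= => nx'.
  by case/and5P=> /= /andP[h _]; lia.
have [_ e _] : _ := w_steps ltac:(lia).
rewrite lab //; rewrite en /= in e; rewrite e.
by have := wl (i := 0) ltac:(lia); lia.
Qed.

Lemma block_type_blowup : block_type L g = T.
Proof.
apply: adj_eq => c d hc hd; case/and5P: (can) => _ _ /forallP supp /forallP diag _.
apply/ext_block_typeP/idP => [[i [j [_ _ hi hj [nij]]]]|hT].
  by rewrite !label_w // => <- <-; rewrite ext_blowup // => /andP[].
rewrite ext_lt in hT.
have /forallP/(_ (Ordinal hd)) := supp (Ordinal hc); rewrite hT /= => /andP[hcl hdl].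
suff [i [j [hi hj nij ei ej]]] : exists i j,
    [/\ i < n, j < n, i != j, nth 0 w i = c & nth 0 w j = d].
  by exists i, j; rewrite !label_w // ext_blowup // nij ei ej ext_lt.
have [i hi ei] := w_ex hcl.
case: (eqVneq c d) => [e|ne].
  subst d; have := diag (Ordinal hc).
  rewrite (bool_irrelevance hd hc) in hT; rewrite hT /= => h2.
  have [j [hj nij ej]] := w_ex2 i h2.
  by exists i, j; rewrite eq_sym.
have [j hj ej] := w_ex hdl.
exists i, j; split=> //; apply: contraNneq ne => e.
by rewrite -ei -ej e.
Qed.

Lemma block_sizes_blowup : block_sizes g = x.
Proof.
apply: (@eq_from_nth _ 0); first by rewrite size_block_sizes num_blocks_blowup.
move=> c _; rewrite nth_block_sizes -card_w; apply: eq_card => i.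
by rewrite !inE label_w.
Qed.

End Canonical.

(** [block_sizes] is a bijection between the two sides, with the blow-up as its inverse. *)
Lemma count_canonical (P : oprop) L n l (T : adj L) : l <= L ->
  #|[pred g : adj n | is_ograph g && P n g & (num_blocks g == l) && (block_type L g == T)]| =
  count [pred x | canonical l T x && P (sumn x) (blowup T (block_word 0 x) (sumn x))]
    (comps l n).
Proof.
move=> lL; set A := [pred g | _ & _]; rewrite -size_filter.
have inj : {in enum A &, injective (@block_sizes n)}.
  move=> g h; rewrite !mem_enum !inE.
  move=> /andP[/andP[og _] /andP[/eqP gl /eqP gT]] /andP[/andP[oh _] /andP[/eqP hl /eqP hT]] e.
  by rewrite -(@blowup_block_type L n g) ?gl // -(@blowup_block_type L n h) ?hl // gT hT e.
rewrite cardE -(size_map (@block_sizes n)); apply: perm_size; apply: uniq_perm.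
- by rewrite map_inj_in_uniq // enum_uniq.
- by rewrite filter_uniq // uniq_comps.
move=> x; rewrite mem_filter mem_comps inE; apply/mapP/idP.
  case=> g; rewrite mem_enum inE => /andP[/andP[og Pg] /andP[/eqP gl /eqP gT]] ->.
  rewrite size_block_sizes sumn_block_sizes gl !eqxx !andbT -gT -gl canonical_block_type ?gl //=.
  by rewrite blowup_block_type ?gl.
case/andP=> /andP[can Px] /andP[/eqP sx /eqP nx]; rewrite nx in Px.
exists (blowup T (block_word 0 x) n); last by rewrite (block_sizes_blowup lL sx nx can).
rewrite mem_enum inE (is_ograph_blowup _ _ (canonical_sym can)) Px.
by rewrite (num_blocks_blowup lL sx nx can) (block_type_blowup lL sx nx can) !eqxx.
Qed.

(** The members fall into finitely many classes by number of blocks and type. Within a class the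
    admissible sizes are cut out by a downward closed condition and by canonicity, both of which
    depend on truncations only. *)
Lemma bounded_blocks_evpoly (P : oprop) L : hereditary P ->
  (forall n (g : adj n), is_ograph g -> P n g -> num_blocks g <= L) ->
  exists K, evpoly K (fun n => (countP P n)%:Z)%R.
Proof.
move=> hP bounded.
pose Q (p : 'I_L.+1 * adj L) := [pred x | canonical p.1 p.2 x
   && P (sumn x) (blowup p.2 (block_word 0 x) (sumn x))].
have e n : countP P n = \sum_(p : 'I_L.+1 * adj L) count (Q p) (comps p.1 n).
  rewrite /countP -sum1_card.
  pose code (g : adj n) : 'I_L.+1 * adj L := (inord (num_blocks g), block_type L g).
  rewrite (partition_big code xpredT) //=; apply: eq_bigr => -[l T] _.
  rewrite -[RHS](@count_canonical P L n l T (leq_ord l)) -sum1_card.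
  apply: eq_bigl => g; rewrite !inE.
  case: (boolP (is_ograph g && P n g)) => //= /andP[og Pg].
  by rewrite xpair_eqE -val_eqE /= inordK // ltnS bounded.
have hQ p : exists K, evpoly K (fun n => (count (Q p) (comps p.1 n))%:Z)%R.
  case: p => l T.
  (* An asymmetric [T] is never canonical, so its class is empty. *)
  case: (boolP [forall c : 'I_L, forall d : 'I_L, T (c, d) == T (d, c)]) => [sT|nsT]; last first.
    exists 0, 0 => n _; rewrite (eq_count (a2 := pred0)) ?count_pred0 // => x /=.
    by rewrite /canonical (negbTE nsT) andbF.
  have sT' : sym_adj T.
    move=> i j; rewrite /ext; case: insubP => [a _ _|_]; case: insubP => [b _ _|_] //.
    by apply/eqP/(forallP (forallP sT a)).
  have [M st] := stable_downset (fun x y sx sy => blowup_downset (l := l) hP sT' sx sy).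
  apply: (stable_count_evpoly (M := maxn 2 M)) => x sx /=.
  have -> : canonical l T (map (minn (maxn 2 M)) x) = canonical l T x.
    rewrite canonical_truncate [RHS]canonical_truncate -map_comp; congr canonical.
    by apply: eq_map => a /=; lia.
  have le : M <= maxn 2 M by lia.
  have {st} [st1 st2] := stable_leq le st sx.
  by split=> /andP[-> /=]; [exact: st1|exact: st2].
suff [K hK] : exists K, evpoly K (fun n =>
    \sum_(p : 'I_L.+1 * adj L) (count (Q p) (comps p.1 n))%:Z)%R.
  exists K; apply: evpoly_eventually_eq hK; exists 0 => n _.
  by rewrite e (big_morph Posz PoszD (erefl _)).
elim: (index_enum _) => [|p s [K hK]].
  by exists 0, 0 => n _; rewrite big_nil.
have [K' hK'] := hQ p; exists (maxn K' K).
have := evpolyD (evpoly_leq (leq_maxl K' K) hK') (evpoly_leq (leq_maxr K' K) hK).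
by apply: evpoly_eventually_eq; exists 0 => n _; rewrite big_cons.
Qed.

Local Open Scope ring_scope.

Theorem theorem13 (P : oprop) :
  hereditary P ->
  (exists m : nat, (countP P m < fib m)%N) ->
  exists (K N : nat) (a : nat -> int),
    forall n : nat, (N <= n)%N ->
      (countP P n)%:Z = \sum_(i < K.+1) a i * ('C(n, i))%:Z.
Proof.
move=> hP [m small].
have [L hL] := breaks_bounded hP small.
have [|K hK] := bounded_blocks_evpoly (L := L) hP.
  (* A nonempty graph has one block more than it has breaks, so fewer than [L] breaks means at most
     [L] blocks. *)
  by case=> // n g og Pg; apply: hL og Pg.
by exists K; apply: evpoly_binomial.
Qed.
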